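(* Let $\mathbb{X}$ and $\mathbb{A}$ be 2-categories and let $(F,U,\eta,\epsilon,f,u)$ be a 2-dimensional adjunction between them, with $F:\mathbb{X}\to\mathbb{A}$ and $U:\mathbb{A}\to\mathbb{X}$. Then $$(T,\eta,\mu,a,p,q)=(UF,\ \eta,\ U\epsilon F,\ U\epsilon\epsilon F,\ Uf,\ uF)$$ is a lax-Gray monad on $\mathbb{X}$, where $U\epsilon\epsilon F$ denotes the modification whose component at an object $X$ of $\mathbb{X}$ is the 2-cell $U(\epsilon_{\epsilon_{FX}})$.
   Context: All 2-categories and 2-functors are strict. **Lax natural transformations.** For 2-functors $S,R:\mathbb{A}\to\mathbb{B}$, a lax natural transformation $\varphi:S\to R$ consists of 1-cells $\varphi_A:SA\to RA$ for each object $A$ and, for each 1-cell $h:A\to B$, a 2-cell $\varphi_h:\varphi_B\cdot Sh\Rightarrow Rh\cdot\varphi_A$, subject to $\varphi_{1_A}=1_{\varphi_A}$, $\varphi_{kh}=(Rk\cdot\varphi_h)\,..\,(\varphi_k\cdot Sh)$, and, for each 2-cell $\zeta:h\Rightarrow h'$, $(R\zeta\cdot\varphi_A)\,..\,\varphi_h=\varphi_{h'}\,..\,(\varphi_B\cdot S\zeta)$. Modifications between lax natural transformations are as usual: a family of 2-cells indexed by objects, compatible with the 2-cells $\varphi_h$. **Notation.** ''$\cdot$'' denotes composition of 1-cells (and, componentwise, of lax natural transformations) and whiskering of 2-cells by 1-cells (componentwise, of modifications by transformations). ''$..$'' denotes vertical composition of 2-cells, and componentwise of modifications, with the rightmost factor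 applied first. Juxtaposition with a 2-functor is whiskering: $(G\varphi)_X=G(\varphi_X)$, $(\varphi G)_X=\varphi_{GX}$, and similarly for modifications. If $\varphi,\psi$ are lax natural transformations such that $\varphi_{\psi_X}$ makes sense, $\varphi\psi$ denotes the modification with components $\varphi_{\psi_X}$. For example: - For $\eta:1\to UF$, $\eta\eta:\eta UF\cdot\eta\Rightarrow UF\eta\cdot\eta$ has components $\eta_{\eta_X}$. - For $\epsilon:FU\to 1$, $\epsilon\epsilon:\epsilon\cdot FU\epsilon\Rightarrow\epsilon\cdot\epsilon FU$ has components $\epsilon_{\epsilon_A}$. **2-dimensional adjunction.** A 2-dimensional adjunction (two-level adjunction) $(F,U,\eta,\epsilon,f,u)$ between 2-categories $\mathbb{X}$ and $\mathbb{A}$ consists of strict 2-functors $F:\mathbb{X}\to\mathbb{A}$, $U:\mathbb{A}\to\mathbb{X}$, lax natural transformations $\eta:1_{\mathbb{X}}\to UF$ and $\epsilon:FU\to 1_{\mathbb{A}}$, and modifications $f:\epsilon F\cdot F\eta\Rightarrow 1_F$ and $u:1_U\Rightarrow U\epsilon\cdot\eta U$ satisfying $$(Uf\cdot\eta)\,..\,(U\epsilon F\cdot\eta\eta)\,..\,(uF\cdot\eta)=1_\eta,\qquad (\epsilon\cdot fU)\,..\,(\epsilon\epsilon\cdot F\eta U)\,..\,(\epsilon\cdot Fu)=1_\epsilon .$$ **Lax-Gray monad.** A lax-Gray monad on a 2-category $\mathbb{X}$ is a 6-tuple $(T,\eta,\mu,a,p,q)$ where $T:\mathbb{X}\to\mathbb{X}$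 is a strict 2-functor, $\eta:1\to T$ and $\mu:T^2\to T$ are lax natural transformations, and $a:\mu\cdot T\mu\Rightarrow\mu\cdot\mu T$, $p:\mu\cdot T\eta\Rightarrow 1_T$, $q:1_T\Rightarrow\mu\cdot\eta T$ are modifications such that the following five equations hold: 1. $(a\cdot\mu T^2)\,..\,(\mu\cdot\mu\mu)\,..\,(a\cdot T^2\mu)=(\mu\cdot aT)\,..\,(a\cdot T\mu T)\,..\,(\mu\cdot Ta)$ 2. $(p\cdot\eta)\,..\,(\mu\cdot\eta\eta)\,..\,(q\cdot\eta)=1_\eta$ 3. $(\mu\cdot pT)\,..\,(a\cdot T\eta T)\,..\,(\mu\cdot Tq)=1_\mu$ 4. $(a\cdot\eta T^2)\,..\,(\mu\cdot\eta\mu)\,..\,(q\cdot\mu)=\mu\cdot qT$ 5. $(p\cdot\mu)\,..\,(\mu\cdot\mu\eta)\,..\,(a\cdot T^2\eta)=\mu\cdot Tp$ Here the modifications $\mu\mu:\mu T\cdot T^2\mu\Rightarrow T\mu\cdot\mu T^2$, $\eta\eta:\eta T\cdot\eta\Rightarrow T\eta\cdot\eta$, $\eta\mu:\eta T\cdot\mu\Rightarrow T\mu\cdot\eta T^2$ and $\mu\eta:\mu T\cdot T^2\eta\Rightarrow T\eta\cdot\mu$ have components $\mu_{\mu_X},\eta_{\eta_X},\eta_{\mu_X},\mu_{\eta_X}$ respectively. *)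

(* Defs.v *)
From Stdlib Require Import Utf8.

Set Implicit Arguments.
Unset Strict Implicit.
Unset Printing Implicit Defensive.

Declare Scope twocat_scope.
Delimit Scope twocat_scope with twocat.
Open Scope twocat_scope.

(* Strict equations between 1-cells are propositional, so some 2-cells have
   to be transported along them.  The choice of the equality proofs is
   immaterial by uniqueness of identity proofs. *)
Definition cast {H : Type} {C : H -> H -> Type} {f f' g g' : H}
    (e : f = f') (e' : g = g') (α : C f g) : C f' g' :=
  eq_rect g (C f') (eq_rect f (fun x => C x g) α f' e) g' e'.

(* Equality of 2-cells whose boundaries agree up to strict equations. *)
Definition cell_eq {H : Type} {C : H -> H -> Type} {f g f' g' : H}
    (α : C f g) (β : C f' g') : Prop :=
  exists (e : f = f') (e' : g = g'), cast e e' α = β.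

Infix "≈" := cell_eq (at level 70, no associativity) : twocat_scope.

(* Horizontal composition is given by its whiskerings, subject to
   interchange. *)
Record two_category : Type := {
  ob :> Type;
  hom : ob -> ob -> Type;
  cell : forall {A B : ob}, hom A B -> hom A B -> Type;
  id1 : forall A : ob, hom A A;
  comp1 : forall {A B C : ob}, hom B C -> hom A B -> hom A C;
  id2 : forall {A B : ob} (f : hom A B), cell f f;
  vcomp : forall {A B : ob} {f g h : hom A B},
    cell g h -> cell f g -> cell f h;
  lwhisk : forall {A B C : ob} (k : hom B C) {f g : hom A B},
    cell f g -> cell (comp1 k f) (comp1 k g);
  rwhisk : forall {A B C : ob} {f g : hom B C},
    cell f g -> forall h : hom A B, cell (comp1 f h) (comp1 g h);

  comp1A : forall (A B C D : ob) (h : hom C D) (g : hom B C) (f : hom A B),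
    comp1 h (comp1 g f) = comp1 (comp1 h g) f;
  comp1_idl : forall (A B : ob) (f : hom A B), comp1 (id1 B) f = f;
  comp1_idr : forall (A B : ob) (f : hom A B), comp1 f (id1 A) = f;

  vcompA : forall (A B : ob) (f g h k : hom A B)
    (γ : cell h k) (β : cell g h) (α : cell f g),
    vcomp γ (vcomp β α) = vcomp (vcomp γ β) α;
  vcomp_idl : forall (A B : ob) (f g : hom A B) (α : cell f g),
    vcomp (id2 g) α = α;
  vcomp_idr : forall (A B : ob) (f g : hom A B) (α : cell f g),
    vcomp α (id2 f) = α;

  lwhisk_id2 : forall (A B C : ob) (k : hom B C) (f : hom A B),
    lwhisk k (id2 f) = id2 (comp1 k f);
  lwhisk_vcomp : forall (A B C : ob) (k : hom B C) (f g h : hom A B)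
    (β : cell g h) (α : cell f g),
    lwhisk k (vcomp β α) = vcomp (lwhisk k β) (lwhisk k α);
  rwhisk_id2 : forall (A B C : ob) (f : hom B C) (h : hom A B),
    rwhisk (id2 f) h = id2 (comp1 f h);
  rwhisk_vcomp : forall (A B C : ob) (f g k : hom B C) (h : hom A B)
    (β : cell g k) (α : cell f g),
    rwhisk (vcomp β α) h = vcomp (rwhisk β h) (rwhisk α h);

  lwhisk_id1 : forall (A B : ob) (f g : hom A B) (α : cell f g),
    lwhisk (id1 B) α ≈ α;
  lwhisk_comp1 : forall (A B C D : ob) (l : hom C D) (k : hom B C)
    (f g : hom A B) (α : cell f g),
    lwhisk (comp1 l k) α ≈ lwhisk l (lwhisk k α);
  rwhisk_id1 : forall (A B : ob) (f g : hom A B) (α : cell f g),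
    rwhisk α (id1 A) ≈ α;
  rwhisk_comp1 : forall (A B C D : ob) (f g : hom C D) (α : cell f g)
    (k : hom B C) (h : hom A B),
    rwhisk α (comp1 k h) ≈ rwhisk (rwhisk α k) h;
  lwhisk_rwhisk : forall (A B C D : ob) (k : hom C D) (f g : hom B C)
    (α : cell f g) (h : hom A B),
    lwhisk k (rwhisk α h) ≈ rwhisk (lwhisk k α) h;

  interchange : forall (A B C : ob) (f g : hom A B) (h k : hom B C)
    (β : cell h k) (α : cell f g),
    vcomp (rwhisk β g) (lwhisk h α) = vcomp (lwhisk k α) (rwhisk β f)
}.

Arguments id1 {_} A.
Arguments id2 {_ A B} f.
Arguments hom {_} A B.
Arguments cell {_ A B} f g.
Arguments comp1 {_ A B C} g f.
Arguments vcomp {_ A B f g h} β α.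
Arguments lwhisk {_ A B C} k {f g} α.
Arguments rwhisk {_ A B C f g} α h.

Infix "·" := comp1 (at level 40, left associativity) : twocat_scope.
Infix "◃" := lwhisk (at level 40, left associativity) : twocat_scope.
Infix "▹" := rwhisk (at level 40, left associativity) : twocat_scope.

(* Primitive projections make composition of [functor_data] definitionally
   associative and unital. *)
#[projections(primitive)]
Record functor_data (X A : two_category) : Type := {
  fob : X -> A;
  fmap1 : forall {x y : X}, hom x y -> hom (fob x) (fob y);
  fmap2 : forall {x y : X} {f g : hom x y},
    cell f g -> cell (fmap1 f) (fmap1 g)
}.

Arguments fob {X A} _ _.
Arguments fmap1 {X A} _ {x y} _.
Arguments fmap2 {X A} _ {x y f g} _.

Record two_functor (X A : two_category) : Type := {
  fdata :> functor_data X A;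
  fmap1_id : forall x : X, fmap1 fdata (id1 x) = id1 (fob fdata x);
  fmap1_comp : forall (x y z : X) (g : hom y z) (f : hom x y),
    fmap1 fdata (g · f) = fmap1 fdata g · fmap1 fdata f;
  fmap2_id : forall (x y : X) (f : hom x y),
    fmap2 fdata (id2 f) = id2 (fmap1 fdata f);
  fmap2_vcomp : forall (x y : X) (f g h : hom x y)
    (β : cell g h) (α : cell f g),
    fmap2 fdata (vcomp β α) = vcomp (fmap2 fdata β) (fmap2 fdata α);
  fmap2_lwhisk : forall (x y z : X) (k : hom y z) (f g : hom x y)
    (α : cell f g),
    fmap2 fdata (k ◃ α) ≈ fmap1 fdata k ◃ fmap2 fdata α;
  fmap2_rwhisk : forall (x y z : X) (f g : hom y z) (α : cell f g)
    (h : hom x y),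
    fmap2 fdata (α ▹ h) ≈ fmap2 fdata α ▹ fmap1 fdata h
}.

Coercion fob : functor_data >-> Funclass.

Arguments fmap1_id {X A} _ x.
Arguments fmap1_comp {X A} _ {x y z} g f.

Definition id_functor_data (X : two_category) : functor_data X X :=
  {| fob := fun x => x;
     fmap1 := fun _ _ f => f;
     fmap2 := fun _ _ _ _ α => α |}.

Definition comp_functor_data {X A B : two_category}
    (G : functor_data A B) (F : functor_data X A) : functor_data X B :=
  {| fob := fun x => G (F x);
     fmap1 := fun _ _ f => fmap1 G (fmap1 F f);
     fmap2 := fun _ _ _ _ α => fmap2 G (fmap2 F α) |}.

Notation "1" := (id_functor_data _) : twocat_scope.
Infix "∘" := comp_functor_data (at level 40, left associativity) :
  twocat_scope.

Lemma cell_eq_trans {H : Type} {C : H -> H -> Type} {f g f' g' f'' g'' : H}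
    (α : C f g) (β : C f' g') (γ : C f'' g'') :
  α ≈ β -> β ≈ γ -> α ≈ γ.
Proof.
  intros [e1 [e2 <-]] [e3 [e4 <-]]; subst; exists eq_refl, eq_refl; reflexivity.
Qed.

Lemma fmap2_cell_eq {X A : two_category} (F : functor_data X A) {x y : X}
    {f g f' g' : hom x y} (α : cell f g) (β : cell f' g') :
  α ≈ β -> fmap2 F α ≈ fmap2 F β.
Proof. intros [e1 [e2 <-]]; subst; exists eq_refl, eq_refl; reflexivity. Qed.

Definition comp_functor {X A B : two_category}
    (G : two_functor A B) (F : two_functor X A) : two_functor X B.
Proof.
  refine {| fdata := G ∘ F |}; cbn; intros.
  - rewrite fmap1_id; apply fmap1_id.
  - rewrite fmap1_comp; apply fmap1_comp.
  - rewrite fmap2_id; apply fmap2_id.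
  - rewrite fmap2_vcomp; apply fmap2_vcomp.
  - eapply cell_eq_trans; [apply fmap2_cell_eq, fmap2_lwhisk | apply fmap2_lwhisk].
  - eapply cell_eq_trans; [apply fmap2_cell_eq, fmap2_rwhisk | apply fmap2_rwhisk].
Defined.

(* Proves an equation between 1-cells that holds by strictness. *)
Ltac strict :=
  cbn;
  repeat first [ rewrite fmap1_comp | rewrite fmap1_id
               | rewrite comp1_idl | rewrite comp1_idr | rewrite comp1A ];
  reflexivity.

Definition vcomp_along {X : two_category} {A B : X} {f g g' h : hom A B}
    (β : cell g' h) (α : cell f g) (e : g = g') : cell f h :=
  vcomp β (cast eq_refl e α).

(* Vertical composition, rightmost factor first, of 2-cells whose
   intermediate 1-cells agree by strictness. *)
Notation "β • α" := (vcomp_along β α ltac:(strict))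
  (at level 50, left associativity, only parsing) : twocat_scope.
Notation "β • α" := (vcomp_along β α _)
  (at level 50, left associativity, only printing) : twocat_scope.

Record lax_data {X A : two_category} (S R : functor_data X A) : Type := {
  lob :> forall x : X, hom (S x) (R x);
  lnat : forall {x y : X} (h : hom x y),
    cell (lob y · fmap1 S h) (fmap1 R h · lob x)
}.

Arguments lnat {X A S R} _ {x y} h.

Record is_lax {X A : two_category} {S R : functor_data X A}
    (φ : lax_data S R) : Prop := {
  lax_id : forall x : X, lnat φ (id1 x) ≈ id2 (φ x);
  lax_comp1 : forall (x y z : X) (k : hom y z) (h : hom x y),
    lnat φ (k · h) ≈ (fmap1 R k ◃ lnat φ h) • (lnat φ k ▹ fmap1 S h);
  lax_cell : forall (x y : X) (h h' : hom x y) (ζ : cell h h'),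
    vcomp (fmap2 R ζ ▹ φ x) (lnat φ h) = vcomp (lnat φ h') (φ y ◃ fmap2 S ζ)
}.

Definition id_lax {X A : two_category} (S : two_functor X A) :
    lax_data S S :=
  {| lob := fun x => id1 (S x);
     lnat := fun x y h =>
       cast (eq_sym (comp1_idl (fmap1 S h))) (eq_sym (comp1_idr (fmap1 S h)))
         (id2 (fmap1 S h)) |}.

Definition comp_lax {X A : two_category} {S R Q : functor_data X A}
    (ψ : lax_data R Q) (φ : lax_data S R) : lax_data S Q :=
  {| lob := fun x => ψ x · φ x;
     lnat := fun x y h =>
       cast (comp1A (ψ y) (φ y) (fmap1 S h))
            (eq_sym (comp1A (fmap1 Q h) (ψ x) (φ x)))
         ((lnat ψ h ▹ φ x) • (ψ y ◃ lnat φ h)) |}.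

Definition lwhisk_lax {X A B : two_category} (G : two_functor A B)
    {S R : functor_data X A} (φ : lax_data S R) : lax_data (G ∘ S) (G ∘ R) :=
  {| lob := fun x => fmap1 G (φ x) : hom ((G ∘ S) x) ((G ∘ R) x);
     lnat := fun x y h =>
       cast (fmap1_comp G (φ y) (fmap1 S h)) (fmap1_comp G (fmap1 R h) (φ x))
         (fmap2 G (lnat φ h)) |}.

Definition rwhisk_lax {X A B : two_category} {S R : functor_data A B}
    (φ : lax_data S R) (G : functor_data X A) : lax_data (S ∘ G) (R ∘ G) :=
  {| lob := fun x => φ (G x) : hom ((S ∘ G) x) ((R ∘ G) x);
     lnat := fun x y h => lnat φ (fmap1 G h) |}.

Infix "⊙" := comp_lax (at level 40, left associativity) : twocat_scope.
Infix "⋉" := lwhisk_lax (at level 30, right associativity) : twocat_scope.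
Infix "⋊" := rwhisk_lax (at level 30, right associativity) : twocat_scope.

Definition mod_data {X A : two_category} {S R : functor_data X A}
    (φ ψ : lax_data S R) : Type :=
  forall x : X, cell (φ x) (ψ x).

Definition is_modification {X A : two_category} {S R : functor_data X A}
    {φ ψ : lax_data S R} (Γ : mod_data φ ψ) : Prop :=
  forall (x y : X) (h : hom x y),
    vcomp (lnat ψ h) (Γ y ▹ fmap1 S h) = vcomp (fmap1 R h ◃ Γ x) (lnat φ h).

Record is_two_adjunction {X A : two_category}
    (F : two_functor X A) (U : two_functor A X)
    (η : lax_data 1 (U ∘ F)) (ε : lax_data (F ∘ U) 1)
    (f : mod_data ((ε ⋊ F) ⊙ (F ⋉ η)) (id_lax F))
    (u : mod_data (id_lax U) ((U ⋉ ε) ⊙ (η ⋊ U))) : Prop := {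
  adj_unit_lax : is_lax η;
  adj_counit_lax : is_lax ε;
  adj_f_mod : is_modification f;
  adj_u_mod : is_modification u;
  adj_unit_eq : forall x : X,
    (fmap2 U (f x) ▹ η x) • (fmap1 U (ε (F x)) ◃ lnat η (η x))
      • (u (F x) ▹ η x) ≈ id2 (η x);
  adj_counit_eq : forall a : A,
    (ε a ◃ f (U a)) • (lnat ε (ε a) ▹ fmap1 F (η (U a)))
      • (ε a ◃ fmap2 F (u a)) ≈ id2 (ε a)
}.

Arguments is_two_adjunction {X A} F U η ε f u.

Record is_lax_gray_monad {X : two_category} (T : two_functor X X)
    (η : lax_data 1 T) (μ : lax_data (T ∘ T) T)
    (a : mod_data (μ ⊙ (T ⋉ μ)) (μ ⊙ (μ ⋊ T)))
    (p : mod_data (μ ⊙ (T ⋉ η)) (id_lax T))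
    (q : mod_data (id_lax T) (μ ⊙ (η ⋊ T))) : Prop := {
  monad_unit_lax : is_lax η;
  monad_mult_lax : is_lax μ;
  monad_a_mod : is_modification a;
  monad_p_mod : is_modification p;
  monad_q_mod : is_modification q;
  monad_eq1 : forall x : X,
    (a x ▹ μ (T (T x))) • (μ x ◃ lnat μ (μ x)) • (a x ▹ fmap1 T (fmap1 T (μ x)))
    ≈ (μ x ◃ a (T x)) • (a x ▹ fmap1 T (μ (T x))) • (μ x ◃ fmap2 T (a x));
  monad_eq2 : forall x : X,
    (p x ▹ η x) • (μ x ◃ lnat η (η x)) • (q x ▹ η x) ≈ id2 (η x);
  monad_eq3 : forall x : X,
    (μ x ◃ p (T x)) • (a x ▹ fmap1 T (η (T x))) • (μ x ◃ fmap2 T (q x))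
    ≈ id2 (μ x);
  monad_eq4 : forall x : X,
    (a x ▹ η (T (T x))) • (μ x ◃ lnat η (μ x)) • (q x ▹ μ x)
    ≈ μ x ◃ q (T x);
  monad_eq5 : forall x : X,
    (p x ▹ μ x) • (μ x ◃ lnat μ (η x)) • (a x ▹ fmap1 T (fmap1 T (η x)))
    ≈ μ x ◃ fmap2 T (p x)
}.

Arguments is_lax_gray_monad {X} T η μ a p q.

(* Main.v *)
Require Import Defs.
From Stdlib Require Import Eqdep.

(** Up to strict equations between 1-cells, the multiplication and the
    modifications [a], [p] of the monad are images under [U] of data in [A],
    and each axiom is a single naturality, modification or triangle equation
    of the adjunction.

    For a lax transformation [ε : FU → 1], naturality of [ε] at the 2-cell
    [ε_h : ε_b · FUh ⇒ h · ε_a], together with the functoriality equations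
    expanding [ε] at the source and at the target of [ε_h], says that the
    2-cells [ε_{ε_a}] form a modification ([counit_counit]).  Its image under
    [U] at [Fh] is the modification property of [a], and at [h = ε_{Fx}] it is
    the equation [monad_eq1].  Naturality of [ε] at the 2-cell [f_x]
    ([counit_lax_section]) gives [monad_eq5].  The modification property of
    [u] at [ε_{Fx}] is [monad_eq4].  The two triangle equations of the
    adjunction give [monad_eq2] and, after applying [U] at [Fx], [monad_eq3].

    Strict equations between 1-cells are absorbed by working up to [≈].  By
    uniqueness of identity proofs, [≈] is a congruence for composition along
    strict equations, whatever proofs of these equations are used
    ([vcomp_along_cong]), and it is equality on 2-cells with the same boundary
    ([cell_eq_eq]).  The tactic [cells] compares two 2-cells that are built in
    the same way. *)

(** * Equality of 2-cells up to strict equations *)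

Lemma cell_eq_refl {H : Type} {C : H -> H -> Type} {f g : H} (α : C f g) :
  α ≈ α.
Proof. exists eq_refl, eq_refl; reflexivity. Qed.

Lemma cell_eq_sym {H : Type} {C : H -> H -> Type} {f g f' g' : H}
    {α : C f g} {β : C f' g'} :
  α ≈ β -> β ≈ α.
Proof. intros [e [e' <-]]; subst; apply cell_eq_refl. Qed.

Lemma eq_cell_eq {H : Type} {C : H -> H -> Type} {f g : H} {α β : C f g} :
  α = β -> α ≈ β.
Proof. intros <-; apply cell_eq_refl. Qed.

Lemma cell_eq_eq {H : Type} {C : H -> H -> Type} {f g : H} (α β : C f g) :
  α ≈ β -> α = β.
Proof.
  intros [e [e' <-]].
  rewrite (UIP_refl _ _ e), (UIP_refl _ _ e'); reflexivity.
Qed.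

Lemma cast_cell_eq {H : Type} {C : H -> H -> Type} {f g f' g' : H}
    (e : f = f') (e' : g = g') (α : C f g) :
  cast e e' α ≈ α.
Proof. subst; apply cell_eq_refl. Qed.

Lemma vcomp_along_cong {X : two_category} {A B : X}
    {f g g' h f1 g1 g1' h1 : hom A B}
    (β : cell g' h) (β1 : cell g1' h1) (α : cell f g) (α1 : cell f1 g1)
    (e : g = g') (e1 : g1 = g1') :
  β ≈ β1 -> α ≈ α1 -> vcomp_along β α e ≈ vcomp_along β1 α1 e1.
Proof.
  intros [d1 [d2 <-]] [d3 [d4 <-]]; destruct d1, d2, d3, d4, e.
  rewrite (UIP_refl _ _ e1); apply cell_eq_refl.
Qed.

Lemma vcomp_alongA {X : two_category} {A B : X}
    {f g g' h h' k : hom A B}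
    (γ : cell h' k) (β : cell g' h) (α : cell f g) (e : g = g') (e' : h = h') :
  vcomp_along γ (vcomp_along β α e) e' ≈ vcomp_along (vcomp_along γ β e') α e.
Proof. subst; apply eq_cell_eq, vcompA. Qed.

Lemma vcomp_along_idl {X : two_category} {A B : X} {f g g' h k : hom A B}
    (β : cell g' h) (α : cell f g) (e : g = g') :
  β ≈ id2 k -> vcomp_along β α e ≈ α.
Proof.
  intros Hβ; apply cell_eq_sym in Hβ; destruct Hβ as [d [d' <-]].
  destruct d, d'; subst; apply eq_cell_eq, vcomp_idl.
Qed.

Lemma vcomp_along_idr {X : two_category} {A B : X} {f g g' h k : hom A B}
    (β : cell g' h) (α : cell f g) (e : g = g') :
  α ≈ id2 k -> vcomp_along β α e ≈ β.
Proof.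
  intros Hα; apply cell_eq_sym in Hα; destruct Hα as [d [d' <-]].
  destruct d, d', e; apply eq_cell_eq, vcomp_idr.
Qed.

Lemma id2_cong {X : two_category} {A B : X} (f f' : hom A B) :
  f = f' -> id2 f ≈ id2 f'.
Proof. intros <-; apply cell_eq_refl. Qed.

Lemma lwhisk_cong {X : two_category} {A B C : X} (k k' : hom B C)
    {f g f' g' : hom A B} (α : cell f g) (α' : cell f' g') :
  k = k' -> α ≈ α' -> k ◃ α ≈ k' ◃ α'.
Proof. intros <- [e [e' <-]]; subst; apply cell_eq_refl. Qed.

Lemma rwhisk_cong {X : two_category} {A B C : X} {f g f' g' : hom B C}
    (α : cell f g) (α' : cell f' g') (h h' : hom A B) :
  α ≈ α' -> h = h' -> α ▹ h ≈ α' ▹ h'.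
Proof. intros [e [e' <-]] <-; subst; apply cell_eq_refl. Qed.

Lemma lnat_cong {X A : two_category} {S R : functor_data X A}
    (φ : lax_data S R) {x y : X} (h h' : hom x y) :
  h = h' -> lnat φ h ≈ lnat φ h'.
Proof. intros <-; apply cell_eq_refl. Qed.

Lemma fmap2_cast {X A : two_category} (G : functor_data X A) {x y : X}
    {f g f' g' : hom x y} (e : f = f') (e' : g = g') (α : cell f g) :
  fmap2 G (cast e e' α) ≈ fmap2 G α.
Proof. subst; apply cell_eq_refl. Qed.

Lemma fmap2_vcomp_along {X A : two_category} (G : two_functor X A) {x y : X}
    {f g g' h : hom x y} (β : cell g' h) (α : cell f g) (e : g = g') :
  fmap2 G (vcomp_along β α e)
  ≈ vcomp_along (fmap2 G β) (fmap2 G α) (f_equal (fmap1 G) e).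
Proof. subst; apply eq_cell_eq, fmap2_vcomp. Qed.

Ltac trans_l H := eapply cell_eq_trans; [apply H |].
Ltac trans_r H := eapply cell_eq_trans; [| apply cell_eq_sym, H].

(* Reduces [α ≈ β] to [α ≈ α'] and [β' ≈ β], where [H : α' ≈ β']. *)
Ltac via H := eapply cell_eq_trans; [| eapply cell_eq_trans; [eapply H |]].

(* Proves [α ≈ β] when both sides become the same expression, up to strict
   equations between 1-cells, once 2-functors are distributed over whiskerings
   and vertical composites and transports are discarded.  Vertical composites
   are not reassociated.  Plain composites are treated as composites along
   [eq_refl], so that a single congruence covers both kinds. *)
Ltac cells :=
  cbn;
  lazymatch goal with
  | |- cast _ _ _ ≈ _ => trans_l @cast_cell_eq; cells
  | |- _ ≈ cast _ _ _ => trans_r @cast_cell_eq; cells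
  | |- fmap2 _ (cast _ _ _) ≈ _ => trans_l @fmap2_cast; cells
  | |- _ ≈ fmap2 _ (cast _ _ _) => trans_r @fmap2_cast; cells
  | |- context [vcomp ?b ?a] =>
      change (vcomp b a) with (vcomp_along b a eq_refl); cells
  | |- fmap2 _ (vcomp_along _ _ _) ≈ _ => trans_l @fmap2_vcomp_along; cells
  | |- _ ≈ fmap2 _ (vcomp_along _ _ _) => trans_r @fmap2_vcomp_along; cells
  | |- fmap2 _ (_ ◃ _) ≈ _ => trans_l @fmap2_lwhisk; cells
  | |- _ ≈ fmap2 _ (_ ◃ _) => trans_r @fmap2_lwhisk; cells
  | |- fmap2 _ (_ ▹ _) ≈ _ => trans_l @fmap2_rwhisk; cells
  | |- _ ≈ fmap2 _ (_ ▹ _) => trans_r @fmap2_rwhisk; cells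
  | |- fmap2 _ (id2 _) ≈ _ => rewrite fmap2_id; cells
  | |- _ ≈ fmap2 _ (id2 _) => rewrite fmap2_id; cells
  | |- vcomp_along _ _ _ ≈ vcomp_along _ _ _ => apply vcomp_along_cong; cells
  | |- _ ◃ _ ≈ _ ◃ _ => apply lwhisk_cong; cells
  | |- _ ▹ _ ≈ _ ▹ _ => apply rwhisk_cong; cells
  | |- fmap2 _ _ ≈ fmap2 _ _ => apply fmap2_cell_eq; cells
  | |- lnat ?φ _ ≈ lnat _ _ => apply (lnat_cong φ); cells
  | |- id2 _ ≈ id2 _ => apply id2_cong; cells
  | |- _ ≈ _ => apply cell_eq_refl
  | |- _ = _ => first [reflexivity | strict]
  end.

(** * Whiskering lax transformations *)

Lemma lwhisk_lax_is_lax {X A B : two_category} (G : two_functor A B)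
    {S R : functor_data X A} (φ : lax_data S R) :
  is_lax φ -> is_lax (G ⋉ φ).
Proof.
  intros Hφ; constructor; intros.
  - via (fmap2_cell_eq G (lax_id Hφ x)); cells.
  - via (fmap2_cell_eq G (lax_comp1 Hφ k h)); cells.
  - apply cell_eq_eq.
    via (fmap2_cell_eq G (eq_cell_eq (lax_cell Hφ ζ))); cells.
Qed.

Lemma rwhisk_lax_is_lax {X A B : two_category} {S R : functor_data A B}
    (φ : lax_data S R) (G : two_functor X A) :
  is_lax φ -> is_lax (φ ⋊ G).
Proof.
  intros Hφ; constructor; intros.
  - via (lax_id Hφ (fob G x)); cells.
  - via (lax_comp1 Hφ (fmap1 G k) (fmap1 G h)); cells.
  - apply (lax_cell Hφ).
Qed.

(** * The counit at its own components *)

(** The 2-cells [ε_{ε_a} : ε_a · FUε_a ⇒ ε_a · ε_{FUa}] form a modification: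
    this is naturality of [ε] at the 2-cell [ε_h]. *)
Lemma counit_counit {X A : two_category} (F : two_functor X A)
    (U : two_functor A X) (ε : lax_data (F ∘ U) 1) (Hε : is_lax ε)
    {a b : A} (h : hom a b) :
  (h ◃ lnat ε (ε a)) • (lnat ε h ▹ fmap1 F (fmap1 U (ε a)))
    • (ε b ◃ fmap2 F (fmap2 U (lnat ε h)))
  ≈ (lnat ε h ▹ ε (fob F (fob U a)))
    • (ε b ◃ lnat ε (fmap1 F (fmap1 U h)))
    • (lnat ε (ε b) ▹ fmap1 F (fmap1 U (fmap1 F (fmap1 U h)))).
Proof.
  (* The first two factors on the left compose to [ε] at the target of [ε_h],
     and the last two on the right to [ε] at its source. *)
  eapply cell_eq_trans.
  { eapply (vcomp_along_cong _ (lnat ε (h · ε a)) _ _ _ eq_refl);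
      [via (cell_eq_sym (lax_comp1 Hε h (ε a))) | apply cell_eq_refl]; cells. }
  via (eq_cell_eq (eq_sym (lax_cell Hε (lnat ε h)))); [cells |].
  eapply cell_eq_trans; [| apply vcomp_alongA].
  eapply (vcomp_along_cong _ _ _ _ eq_refl); [apply cell_eq_refl |].
  via (lax_comp1 Hε (ε b) (fmap1 F (fmap1 U h))); cells.
  Unshelve. all: strict.
Qed.

(** Naturality of [ε] at a 2-cell [ζ] exhibiting [s] as a lax section of
    [ε_a], with [ε] at the source [ε_a · s] of [ζ] expanded. *)
Lemma counit_lax_section {X A : two_category} (F : two_functor X A)
    (U : two_functor A X) (ε : lax_data (F ∘ U) 1) (Hε : is_lax ε)
    {a : A} (s : hom a (fob F (fob U a))) (ζ : cell (ε a · s) (id1 a)) :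
  (ζ ▹ ε a) • (ε a ◃ lnat ε s) • (lnat ε (ε a) ▹ fmap1 F (fmap1 U s))
  ≈ ε a ◃ fmap2 F (fmap2 U ζ).
Proof.
  eapply cell_eq_trans; [apply cell_eq_sym, vcomp_alongA |].
  eapply cell_eq_trans.
  { eapply (vcomp_along_cong _ (ζ ▹ ε a) _ (lnat ε (ε a · s)) _ eq_refl);
      [| via (cell_eq_sym (lax_comp1 Hε (ε a) s))]; cells. }
  via (eq_cell_eq (lax_cell Hε ζ)); [cells |].
  (* The target of [ζ] is an identity, where [ε] is an identity 2-cell. *)
  apply vcomp_along_idl with (e := eq_refl) (1 := lax_id Hε a).
  Unshelve. all: strict.
Qed.

(** * The lax-Gray monad of an adjunction *)

Theorem theorem3p1 (X A : two_category)
    (F : two_functor X A) (U : two_functor A X)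
    (η : lax_data 1 (U ∘ F)) (ε : lax_data (F ∘ U) 1)
    (f : mod_data ((ε ⋊ F) ⊙ (F ⋉ η)) (id_lax F))
    (u : mod_data (id_lax U) ((U ⋉ ε) ⊙ (η ⋊ U))) :
  is_two_adjunction F U η ε f u ->
  is_lax_gray_monad (comp_functor U F) η (U ⋉ ε ⋊ F)
    (fun x => cast (fmap1_comp U _ _) (fmap1_comp U _ _)
                (fmap2 U (lnat ε (ε (F x)))))
    (fun x => cast (fmap1_comp U _ _) (fmap1_id U _) (fmap2 U (f x)))
    (fun x => u (F x)).
Proof.
  intros [Hη Hε Hf Hu Hunit Hcounit].
  constructor.
  - exact Hη.
  - exact (lwhisk_lax_is_lax U _ (rwhisk_lax_is_lax ε F Hε)).
  - intros x y h; apply cell_eq_eq.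
    via (cell_eq_sym (fmap2_cell_eq U (counit_counit F U ε Hε (fmap1 F h))));
      [cells |].
    (* The 2-cells of [μ · Tμ] associate the last two factors first. *)
    eapply cell_eq_trans;
      [eapply (fmap2_cell_eq U (cell_eq_sym (vcomp_alongA _ _ _ _ _))) |]; cells.
  - intros x y h; apply cell_eq_eq.
    via (fmap2_cell_eq U (eq_cell_eq (Hf _ _ h))); cells.
  - intros x y h; apply cell_eq_eq.
    via (eq_cell_eq (Hu _ _ (fmap1 F h))); cells.
  - intros x.
    via (cell_eq_sym (fmap2_cell_eq U (counit_counit F U ε Hε (ε (fob F x)))));
      cells.
  - intros x. via (Hunit x); cells.
  - intros x. via (fmap2_cell_eq U (Hcounit (F x))); cells.
  - intros x. via (eq_cell_eq (Hu _ _ (ε (F x)))).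
    + cells.
    + (* The 2-cells of the identity transformation are transported
         identities. *)
      eapply vcomp_along_idr with (e := eq_refl); apply cast_cell_eq.
  - intros x.
    via (fmap2_cell_eq U
           (counit_lax_section F U ε Hε (a := fob F x) (fmap1 F (η x)) (f x)));
      cells.
Qed.
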